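(* Let $M$ be positive semidefinite and suppose that $\bar z$ is a solution of the nominal LCP$(\bar q,M)$. Consider the linear feasibility problem of finding $r\in\mathbb{R}^n$ and $A,C,D\in\mathbb{R}^{n\times n}$ such that \begin{align*} & r\ge 0,\quad \bar q+Mr\ge 0,\\ & \bar q^\top(r-\bar z)=0,\\ & (M+M^\top)(r-\bar z)=0,\\ & D_{L,\cdot}=0,\quad D_{[h],\cdot}=0,\quad D_{\cdot,S}=0,\\ & \begin{bmatrix}M_{P\cap S,P}\\ M_{P\cap U,P}\end{bmatrix}\begin{bmatrix}D_{P,P\cap U}& D_{P,L\cap U}\end{bmatrix}=\begin{bmatrix}0&0\\ -\mathbb{I}_{P\cap U}&0\end{bmatrix},\\ & A_{i,j}\le -D_{i,j}\bar u_j,\quad i\in P,\ j\in U,\\ & A_{i,j}\le D_{i,j}\bar u_j,\quad i\in P,\ j\in U,\\ & \sum_{j\in U}A_{i,j}+r_i\ge 0,\quad i\in P,\\ & C_{i,j}\le -(M_{i,\cdot}D_{\cdot,j}+\delta_{ij})\bar u_j,\quad i\in L,\ j\in U,\\ & C_{i,j}\le (M_{i,\cdot}D_{\cdot,j}+\delta_{ij})\bar u_j,\quad i\in L,\ j\in U,\\ & \sum_{j\in U}C_{i,j}+M_{i,\cdot}r+\bar q_i\ge 0,\quad i\in L. \end{align*} Every feasible point $(r,A,C,D)$ of this problem corresponds to an AAR solution of the form $z(u)=Du+r$ of the uncertain LCP $$0\le z(u)\perp Mz(u)+q(u)\ge 0\quad\text{for all } u\in\mathcal{U}.$$ If the problem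 is infeasible, then no AAR solution exists.
   Context: Notation: $[n]=\{1,\dots,n\}$ and $[h]=\{1,\dots,h\}$ ($[0]=\emptyset$). For a matrix $A$ and index sets $I,J$, $A_{I,J}$ is the submatrix with rows in $I$ and columns in $J$, $A_I=A_{I,I}$, $A_{i,\cdot}$ is the $i$-th row and $A_{\cdot,j}$ the $j$-th column; $b_I$ is the subvector of $b$ indexed by $I$; $\delta_{ij}$ is the Kronecker delta; $\mathbb{I}_T$ is the identity matrix indexed by $T$. Vector inequalities are componentwise, and $0\le a\perp b\ge 0$ means $a\ge0$, $b\ge0$, $a^\top b=0$. A (not necessarily symmetric) matrix $M\in\mathbb{R}^{n\times n}$ is positive semidefinite if $x^\top Mx\ge0$ for all $x\in\mathbb{R}^n$. Data: $M\in\mathbb{R}^{n\times n}$, $\bar q\in\mathbb{R}^n$, $\bar u\in\mathbb{R}^n_{\ge0}$, $h\in\{0,\dots,n\}$. The uncertainty set is the box $\mathcal{U}=\{u\in\mathbb{R}^n: -\bar u_i\le u_i\le \bar u_i,\ i\in[n]\}$, and $q(u)=\bar q+u$ for $u\in\mathcal{U}$. Let $U=\{i\in[n]:\bar u_i>0\}$ and $S=\{i\in[n]:\bar u_i=0\}$. LCP$(\bar q,M)$ is the problem of finding $z\in\mathbb{R}^n$ with $0\le z\perp Mz+\bar q\ge0$; its solution set is SOL$(\bar q,M)$. Define $P=\{j\in[n]:\exists z\in\mathrm{SOL}(\bar q,M)\text{ with } z_j>0\}$ and $L=[n]\setminus P$. An affinely adjustable robust (AAR) solution of the uncertain LCP is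 an affine function $z(u)=Du+r$ with $D\in\mathbb{R}^{n\times n}$, $r\in\mathbb{R}^n$, $D_{[h],\cdot}=0$ (the first $h$ variables are non-adjustable) and, by convention, $D_{\cdot,S}=0$, such that $0\le z(u)\perp Mz(u)+q(u)\ge0$ for all $u\in\mathcal{U}$. *)

(* Defs.v *)
From mathcomp Require Import all_boot all_order all_algebra.
From mathcomp Require Import boolp reals.

Set Implicit Arguments.
Unset Strict Implicit.
Unset Printing Implicit Defensive.

Import Order.TTheory GRing.Theory Num.Theory.
Local Open Scope ring_scope.

(* Indices are 0-based: the index set {1,...,n} is 'I_n, and the initial      *)
(* segment {1,...,h} is {i : 'I_n | i < h}.                                   *)

Section LCP.
Variables (R : realType) (n : nat).
Implicit Types (M A C D : 'M[R]_n) (q u z r : 'cV[R]_n) (I J : {set 'I_n}).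

(* Symmetry of M is not required. *)
Definition possemidef M : Prop := forall x : 'cV[R]_n, 0 <= (x^T *m M *m x) 0 0.

Definition vec_ge0 z : Prop := forall i, 0 <= z i 0.

Definition perp_ge0 (a b : 'cV[R]_n) : Prop := [/\ vec_ge0 a, vec_ge0 b & a^T *m b = 0].

Definition lcp_sol q M z : Prop := perp_ge0 z (M *m z + q).

Definition lcp_P q M : {set 'I_n} :=
  [set j | `[< exists z, lcp_sol q M z /\ 0 < z j 0 >]].

Definition lcp_L q M : {set 'I_n} := ~: lcp_P q M.

Definition in_box (ubar u : 'cV[R]_n) : Prop :=
  forall i, - ubar i 0 <= u i 0 <= ubar i 0.

Definition box_U (ubar : 'cV[R]_n) : {set 'I_n} := [set i | 0 < ubar i 0].

Definition box_S (ubar : 'cV[R]_n) : {set 'I_n} := [set i | ubar i 0 == 0].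

Definition affine D r : 'cV[R]_n -> 'cV[R]_n := fun u => D *m u + r.

Definition aar_sol M (qbar ubar : 'cV[R]_n) (h : nat)
    (z : 'cV[R]_n -> 'cV[R]_n) : Prop :=
  exists D r,
    [/\ z = affine D r,
        forall i j : 'I_n, (i < h)%N -> D i j = 0,
        forall i j : 'I_n, j \in box_S ubar -> D i j = 0
      & forall u, in_box ubar u -> perp_ge0 (z u) (M *m z u + (qbar + u))].

(* The submatrix A_{I,J}; rows and columns keep their increasing order. *)
Definition mxrestr I J A : 'M[R]_(#|I|, #|J|) :=
  \matrix_(i, j) A (enum_val i) (enum_val j).

Record aar_feasible M (qbar ubar : 'cV[R]_n) (h : nat)
    (zbar : 'cV[R]_n) r A C D : Prop := {
  feas_r_ge0 : vec_ge0 r;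
  feas_w_ge0 : vec_ge0 (qbar + M *m r);
  feas_q : qbar^T *m (r - zbar) = 0;
  feas_sym : (M + M^T) *m (r - zbar) = 0;
  feas_D_L : forall i j, i \in lcp_L qbar M -> D i j = 0;
  feas_D_h : forall i j : 'I_n, (i < h)%N -> D i j = 0;
  feas_D_S : forall i j, j \in box_S ubar -> D i j = 0;
  feas_block :
    let P := lcp_P qbar M in let L := lcp_L qbar M in
    let U := box_U ubar in let S := box_S ubar in
    col_mx (mxrestr (P :&: S) P M) (mxrestr (P :&: U) P M)
      *m row_mx (mxrestr P (P :&: U) D) (mxrestr P (L :&: U) D)
    = block_mx 0 0 (- 1%:M) 0;
  feas_A_le_opp : forall i j, i \in lcp_P qbar M -> j \in box_U ubar ->
    A i j <= - D i j * ubar j 0;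
  feas_A_le : forall i j, i \in lcp_P qbar M -> j \in box_U ubar ->
    A i j <= D i j * ubar j 0;
  feas_A_sum : forall i, i \in lcp_P qbar M ->
    0 <= (\sum_(j in box_U ubar) A i j) + r i 0;
  feas_C_le_opp : forall i j, i \in lcp_L qbar M -> j \in box_U ubar ->
    C i j <= - ((M *m D) i j + (i == j)%:R) * ubar j 0;
  feas_C_le : forall i j, i \in lcp_L qbar M -> j \in box_U ubar ->
    C i j <= ((M *m D) i j + (i == j)%:R) * ubar j 0;
  feas_C_sum : forall i, i \in lcp_L qbar M ->
    0 <= (\sum_(j in box_U ubar) C i j) + (M *m r) i 0 + qbar i 0
}.

End LCP.

(* Main.v *)
Require Import Defs.
From mathcomp Require Import all_boot all_order all_algebra.
From mathcomp Require Import boolp reals.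
From mathcomp Require Import ring lra.
Set Implicit Arguments.
Unset Strict Implicit.
Unset Printing Implicit Defensive.

Import Order.TTheory GRing.Theory Num.Theory.
Local Open Scope ring_scope.

(** For positive semidefinite M, any two solutions z, z' of LCP(q, M) are
    cross-complementary, z^T (M z' + q) = 0. Hence M z + q vanishes on P for
    every solution z, while z vanishes on L. An AAR solution D u + r has r as a
    nominal solution (take u = 0), and a function linear in u that is
    nonnegative on the symmetric box vanishes on it: this applies to the rows
    of D indexed by L and to the rows of M D + I indexed by P. On the remaining
    rows, nonnegativity over the box is its worst case c >= sum |b_j| ubar_j,
    which A and C linearize. *)

(** * Scalar products and the kernel of a positive semidefinite form *)

Section Dot.
Variables (R : realType) (n : nat).
Implicit Types (M : 'M[R]_n) (x y z : 'cV[R]_n).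

Definition dot x y : R := (x^T *m y) 0 0.

Lemma dotE x y : dot x y = \sum_i x i 0 * y i 0.
Proof. by rewrite /dot mxE; apply: eq_bigr => i _; rewrite mxE. Qed.

Lemma dotC x y : dot x y = dot y x.
Proof. by rewrite !dotE; apply: eq_bigr => i _; rewrite mulrC. Qed.

Lemma dotDr x y z : dot x (y + z) = dot x y + dot x z.
Proof. by rewrite /dot mulmxDr mxE. Qed.

Lemma dotDl x y z : dot (x + y) z = dot x z + dot y z.
Proof. by rewrite dotC dotDr !(dotC z). Qed.

Lemma dotNr x y : dot x (- y) = - dot x y.
Proof. by rewrite /dot mulmxN mxE. Qed.

Lemma dotNl x y : dot (- x) y = - dot x y.
Proof. by rewrite dotC dotNr dotC. Qed.

Lemma dotZr a x y : dot x (a *: y) = a * dot x y.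
Proof. by rewrite /dot -scalemxAr mxE. Qed.

Lemma dotZl a x y : dot (a *: x) y = a * dot x y.
Proof. by rewrite dotC dotZr dotC. Qed.

Lemma dot_trmx M x y : dot x (M^T *m y) = dot y (M *m x).
Proof. by rewrite dotC /dot trmx_mul trmxK mulmxA. Qed.

Lemma dot_eq0P x y : reflect (x^T *m y = 0) (dot x y == 0).
Proof.
apply: (iffP eqP) => [xy0|xy0]; last by rewrite /dot xy0 mxE.
by apply/matrixP=> i j; rewrite !ord1 [RHS]mxE.
Qed.

Lemma dotxx_eq0 x : (dot x x == 0) = (x == 0).
Proof.
apply/eqP/eqP => [|->]; last by rewrite /dot mulmx0 mxE.
rewrite dotE => /eqP; rewrite psumr_eq0; last first.
  by move=> i _; rewrite -expr2 sqr_ge0.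
move=> /allP x0; apply/matrixP=> i j; rewrite ord1 [RHS]mxE.
have := x0 i (mem_index_enum i).
by rewrite /= -expr2 sqrf_eq0 => /eqP.
Qed.

Lemma dot_ge0 x y : vec_ge0 x -> vec_ge0 y -> 0 <= dot x y.
Proof. by move=> x0 y0; rewrite dotE sumr_ge0 // => i _; rewrite mulr_ge0. Qed.

Lemma dot_ge0_eq0 x y i :
  vec_ge0 x -> vec_ge0 y -> dot x y = 0 -> x i 0 * y i 0 = 0.
Proof.
move=> x0 y0 /eqP; rewrite dotE psumr_eq0; last by move=> k _; rewrite mulr_ge0.
by move=> /allP/(_ i (mem_index_enum i)) /eqP.
Qed.

Lemma possemidef_dot M x : possemidef M -> 0 <= dot x (M *m x).
Proof. by rewrite /dot mulmxA; apply. Qed.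

(* The form at y + t x is affine in t with slope y^T (M + M^T) x. *)
Lemma possemidef_ker M x :
  possemidef M -> dot x (M *m x) = 0 -> (M + M^T) *m x = 0.
Proof.
move=> psdM x0; apply/eqP; rewrite -dotxx_eq0.
set y := (M + M^T) *m x; set s := dot y y.
have form_line t : dot (y + t *: x) (M *m (y + t *: x)) = dot y (M *m y) + t * s.
  rewrite /s {6}/y mulmxDr -scalemxAr mulmxDl !(dotDl, dotDr, dotZl, dotZr).
  by rewrite dot_trmx x0; ring.
apply/negPn/negP => s_neq0.
(* This value of [t] makes the affine function equal to [-1], against semidefiniteness. *)
have := possemidef_dot (y + (- (dot y (M *m y) + 1) / s) *: x) psdM.
by rewrite form_line divfK //; lra.
Qed.

End Dot.

(** * The solution set of a positive semidefinite LCP *)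

Section LcpSolutions.
Variables (R : realType) (n : nat) (M : 'M[R]_n) (q : 'cV[R]_n).
Hypothesis psdM : possemidef M.
Implicit Types (r z : 'cV[R]_n).

Lemma lcp_sol_dot z : lcp_sol q M z -> dot z (M *m z) + dot z q = 0.
Proof. by case=> _ _ /dot_eq0P/eqP; rewrite dotDr. Qed.

Lemma dot_subr_subr r z : dot (r - z) (M *m (r - z)) =
  dot r (M *m r) + dot z (M *m z) - dot r (M *m z) - dot z (M *m r).
Proof. rewrite mulmxBr !(dotDl, dotDr, dotNl, dotNr); ring. Qed.

(** Complementarity of [r] and of [z] turns the form at [r - z] into
    [- r^T (M z + q) - z^T (M r + q)]. The form is nonnegative and both scalar products are
    nonnegative, so all three vanish. *)
Lemma lcp_sol_cross r z : lcp_sol q M r -> lcp_sol q M z ->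
  dot z (M *m r + q) = 0 /\ dot (r - z) (M *m (r - z)) = 0.
Proof.
move=> solr solz; have rr := lcp_sol_dot solr; have zz := lcp_sol_dot solz.
case: solr solz => r0 wr0 _ [z0 wz0 _].
have := dot_ge0 r0 wz0; have := dot_ge0 z0 wr0.
have := possemidef_dot (r - z) psdM; rewrite dot_subr_subr !dotDr.
by split; lra.
Qed.

Lemma lcp_sol_L z i : lcp_sol q M z -> i \in lcp_L q M -> z i 0 = 0.
Proof.
move=> solz; rewrite !inE => /asboolPn notP; apply/eqP; rewrite eq_le.
case: (solz) => z_ge0 _ _; rewrite z_ge0 andbT leNgt; apply/negP=> zi.
by apply: notP; exists z.
Qed.

(** Some solution [y] has a positive entry at [i]; cross-complementarity of [y] and [z] holds
    termwise because all the terms are nonnegative. *)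
Lemma lcp_sol_P z i : lcp_sol q M z -> i \in lcp_P q M -> (M *m z + q) i 0 = 0.
Proof.
move=> solz; rewrite inE => /asboolP [y [soly yi]].
have [yw _] := lcp_sol_cross solz soly.
case: solz soly => _ w0 _ [y0 _ _].
have /eqP := dot_ge0_eq0 i y0 w0 yw.
by rewrite mulf_eq0 gt_eqF //= => /eqP.
Qed.

(** The kernel condition makes the quadratic forms at [r] and [zbar] equal, and then [r] is
    complementary exactly when [q^T r = q^T zbar]. For a solution [r] the kernel condition comes
    from [lcp_sol_cross] and [possemidef_ker]. *)
Lemma lcp_solP zbar r : lcp_sol q M zbar ->
  lcp_sol q M r <->
  [/\ vec_ge0 r, vec_ge0 (q + M *m r), q^T *m (r - zbar) = 0
    & (M + M^T) *m (r - zbar) = 0].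
Proof.
move=> solz; have zz := lcp_sol_dot solz.
(* [r^T M r = z^T M z], as twice each equals [r^T (M + M^T) z] *)
have eq_form : (M + M^T) *m (r - zbar) = 0 ->
    dot r (M *m r) = dot zbar (M *m zbar).
  rewrite mulmxDl mulmxBr (mulmxBr M^T) => E.
  have dot_E y : dot y (M *m r - M *m zbar + (M^T *m r - M^T *m zbar)) = 0.
    by rewrite E /dot mulmx0 mxE.
  have := dot_E r; have := dot_E zbar.
  by rewrite !(dotDr, dotNr) !dot_trmx; lra.
split=> [solr|[r0 wr0 /dot_eq0P/eqP qr symr]].
  have rr := lcp_sol_dot solr.
  have [_ /(possemidef_ker psdM) symr] := lcp_sol_cross solr solz.
  case: solr => r0 wr0 _; split=> //; first by rewrite addrC.
  apply/dot_eq0P/eqP; rewrite dotDr dotNr (dotC q r) (dotC q zbar).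
  by have := eq_form symr; lra.
split=> //; first by rewrite addrC.
apply/dot_eq0P/eqP; rewrite dotDr.
move: qr; rewrite dotDr dotNr (dotC q r) (dotC q zbar).
by have := eq_form symr; lra.
Qed.

End LcpSolutions.

(** * Linear inequalities that hold over the whole box *)

Section Box.
Variables (R : realType) (n : nat) (ubar : 'cV[R]_n).
Hypothesis ubar_ge0 : forall i, 0 <= ubar i 0.
Implicit Types (B : 'M[R]_n) (u : 'cV[R]_n).

Lemma box_SU j : (j \in box_S ubar) = (j \notin box_U ubar).
Proof. by rewrite !inE lt_neqAle ubar_ge0 andbT negbK eq_sym. Qed.

Lemma in_box0 : in_box ubar 0.
Proof. by move=> i; rewrite mxE oppr_le0 ubar_ge0. Qed.

Lemma in_box_S u j : in_box ubar u -> j \notin box_U ubar -> u j 0 = 0.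
Proof.
move=> /(_ j) uj; rewrite -box_SU inE => /eqP uj0.
by apply/eqP; rewrite eq_le; move: uj; rewrite uj0 oppr0 andbC.
Qed.

Lemma mulmx_box B u i : in_box ubar u ->
  (B *m u) i 0 = \sum_(j in box_U ubar) B i j * u j 0.
Proof.
move=> inu; rewrite mxE [RHS]big_mkcond /=; apply: eq_bigr => j _.
by case: ifPn => // /(in_box_S inu) ->; rewrite mulr0.
Qed.

Lemma box_row_ge0P B i c :
  (forall u, in_box ubar u -> 0 <= (B *m u) i 0 + c) <->
  \sum_(j in box_U ubar) `|B i j| * ubar j 0 <= c.
Proof.
split=> [rob|le_c u inu].
  (* The vertex-like point of the box that minimizes row [i] of [B *m u]. *)
  pose u := \col_j (- Num.sg (B i j) * ubar j 0).
  have inu : in_box ubar u.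
    move=> j; rewrite mxE -ler_norml normrM normrN (ger0_norm (ubar_ge0 j)).
    by rewrite ler_piMl ?ubar_ge0 // normr_sg lern1 leq_b1.
  have := rob u inu; rewrite mulmx_box //.
  rewrite (eq_bigr (fun j => - (`|B i j| * ubar j 0))); last first.
    by move=> j _; rewrite mxE normrEsg mulNr mulrN mulrA [B i j * _]mulrC.
  by rewrite sumrN addrC subr_ge0.
rewrite mulmx_box //; rewrite -[X in _ <= X + _]opprK -sumrN addrC subr_ge0.
apply: le_trans le_c; apply: ler_sum => j _.
rewrite (le_trans (ler_norm _)) // normrN normrM ler_wpM2l // ler_norml.
exact: inu.
Qed.

(** The worst case with [c = 0]: a sum of nonnegative terms is at most 0, so each term vanishes, and
    [ubar j 0] is positive on [box_U ubar]. *)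
Lemma box_row_eq0 B i j :
  (forall u, in_box ubar u -> 0 <= (B *m u) i 0) -> j \in box_U ubar -> B i j = 0.
Proof.
move=> rob jU; have : \sum_(j in box_U ubar) `|B i j| * ubar j 0 <= 0.
  by apply/box_row_ge0P => u /rob; rewrite addr0.
have terms_ge0 k : k \in box_U ubar -> 0 <= `|B i k| * ubar k 0.
  by rewrite mulr_ge0.
move=> le0; have /eqP : \sum_(j in box_U ubar) `|B i j| * ubar j 0 = 0.
  by apply/eqP; rewrite eq_le le0 sumr_ge0.
rewrite psumr_eq0 // => /allP /(_ j (mem_index_enum j)) /implyP /(_ jU).
have uj_gt0 : 0 < ubar j 0 by move: jU; rewrite inE.
by rewrite mulf_eq0 normr_eq0 (gt_eqF uj_gt0) orbF => /eqP.
Qed.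

End Box.

(** * Submatrices and the block equation *)

Section Blocks.
Variables (R : realType) (n : nat).
Implicit Types (X Y M D : 'M[R]_n) (I J K : {set 'I_n}).

Lemma mxrestr_mul I J K M D : (forall i j, i \notin K -> D i j = 0) ->
  mxrestr I K M *m mxrestr K J D = mxrestr I J (M *m D).
Proof.
move=> D0; apply/matrixP=> i j; rewrite !mxE.
rewrite (bigID (mem K)) /= [X in _ + X]big1 ?addr0; last first.
  by move=> k kK; rewrite D0 ?mulr0.
rewrite [RHS](big_enum_val (fun k => M (enum_val i) k * D k (enum_val j))).
by apply: eq_bigr => k _; rewrite !mxE.
Qed.

Lemma eq_mxrestr I J X Y :
  mxrestr I J X = mxrestr I J Y <-> {in I & J, forall i j, X i j = Y i j}.
Proof.
split=> [/matrixP E i j iI jJ|E].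
  have := E (enum_rank_in iI i) (enum_rank_in jJ j).
  by rewrite !mxE !enum_rankK_in.
by apply/matrixP=> i j; rewrite !mxE E // enum_valP.
Qed.

Lemma mxrestr1 I : mxrestr I I 1%:M = 1%:M :> 'M[R]__.
Proof. by apply/matrixP=> i j; rewrite !mxE (inj_eq enum_val_inj). Qed.

Lemma mxrestrN I J X : mxrestr I J (- X) = - mxrestr I J X.
Proof. by apply/matrixP=> i j; rewrite !mxE. Qed.

Lemma mxrestr1_disjoint I J : [disjoint I & J] -> mxrestr I J 1%:M = 0 :> 'M[R]_(_, _).
Proof.
move=> dIJ; apply/matrixP=> i j; rewrite !mxE; case: eqP => // eij.
by have := disjointFr dIJ (enum_valP i); rewrite eij enum_valP.
Qed.

(** Since the rows of [D] outside [P] vanish, the product of blocks consists of blocks of [M *m D].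
    The right-hand side consists of the same blocks of [- 1%:M], of which only the one on [P :&: U]
    meets the diagonal. *)
Lemma feas_blockP M D (P U S : {set 'I_n}) :
  (forall j, (j \in S) = (j \notin U)) ->
  (forall i j, i \notin P -> D i j = 0) ->
  col_mx (mxrestr (P :&: S) P M) (mxrestr (P :&: U) P M)
    *m row_mx (mxrestr P (P :&: U) D) (mxrestr P (~: P :&: U) D)
  = block_mx 0 0 (- 1%:M) 0 <->
  {in P & U, forall i j, (M *m D + 1%:M) i j = 0}.
Proof.
move=> SU D0; rewrite mul_col_row !mxrestr_mul // -mxrestr1 -mxrestrN.
have off I J : [disjoint I & J] -> 0 = mxrestr I J (- 1%:M) :> 'M[R]_(_, _).
  by move=> dIJ; rewrite mxrestrN mxrestr1_disjoint ?oppr0.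
have d1 : [disjoint P :&: S & P :&: U].
  by rewrite -setI_eq0; apply/eqP/setP=> j; rewrite !inE SU; do 2 case: (j \in _).
have d2 : [disjoint P :&: S & ~: P :&: U].
  by rewrite -setI_eq0; apply/eqP/setP=> j; rewrite !inE; case: (j \in P); rewrite ?andbF.
have d3 : [disjoint P :&: U & ~: P :&: U].
  by rewrite -setI_eq0; apply/eqP/setP=> j; rewrite !inE; case: (j \in P); rewrite ?andbF.
rewrite (off _ _ d1) (off _ _ d2) (off _ _ d3).
have opp1 i j : ((M *m D + 1%:M) i j = 0) <-> ((M *m D) i j = (- 1%:M : 'M[R]_n) i j).
  rewrite [(M *m D + 1%:M) i j]mxE [(- 1%:M : 'M_n) i j]mxE.
  by split=> [/eqP|->]; [rewrite addr_eq0 => /eqP | rewrite addNr].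
split=> [/eq_block_mx [E1 E2 E3 E4] i j iP jU|E].
  (* Membership of [i] in [U] selects the block row, that of [j] in [P] the block column. *)
  apply/opp1; have [iU|iS] := boolP (i \in U); have [jP|jL] := boolP (j \in P).
  - by move/eq_mxrestr: E3; apply; rewrite !inE ?iP ?iU ?jP ?jU.
  - by move/eq_mxrestr: E4; apply; rewrite !inE ?iP ?iU ?jL ?jU.
  - by move/eq_mxrestr: E1; apply; rewrite !inE ?SU ?iP ?iS ?jP ?jU.
  - by move/eq_mxrestr: E2; apply; rewrite !inE ?SU ?iP ?iS ?jL ?jU.
congr block_mx; apply/eq_mxrestr => i j; rewrite !inE => /andP[iP _] /andP[_ jU];
  by apply/opp1/E.
Qed.

End Blocks.

(** * Feasible points and AAR solutions *)

Theorem theorem3 (R : realType) (n : nat) (M : 'M[R]_n) (qbar ubar : 'cV[R]_n)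
    (h : nat) (zbar : 'cV[R]_n)
    (ubar_ge0 : forall i, 0 <= ubar i 0)
    (le_hn : (h <= n)%N)
    (M_psd : possemidef M)
    (zbar_sol : lcp_sol qbar M zbar) :
  (forall (r : 'cV[R]_n) (A C D : 'M[R]_n),
      aar_feasible M qbar ubar h zbar r A C D ->
      aar_sol M qbar ubar h (affine D r)) /\
  (~ (exists (r : 'cV[R]_n) (A C D : 'M[R]_n),
        aar_feasible M qbar ubar h zbar r A C D) ->
   ~ (exists z : 'cV[R]_n -> 'cV[R]_n, aar_sol M qbar ubar h z)).
Proof.
(* Splits the slack into a part linear in [u] and the nominal slack at [r]; on the rows in [P] each
   part is shown to vanish separately. *)
have wE (D : 'M[R]_n) (r u : 'cV[R]_n) : M *m affine D r u + (qbar + u) =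
    (M *m D + 1%:M) *m u + (M *m r + qbar).
  rewrite /affine mulmxDr mulmxDl mul1mx mulmxA.
  by rewrite -!addrA; congr (_ + _); rewrite addrA addrC.
have notL i : (i \notin lcp_P qbar M) = (i \in lcp_L qbar M) by rewrite !inE.
have BE (D : 'M[R]_n) i j :
    (M *m D + 1%:M) i j = (M *m D) i j + (i == j)%:R by rewrite [LHS]mxE [1%:M i j]mxE.
split.
  move=> r A C D [r0 w0 qr symr DL Dh DS blk A1 A2 A3 C1 C2 C3].
  have solr : lcp_sol qbar M r by apply/(lcp_solP M_psd r zbar_sol).
  have BP : {in lcp_P qbar M & box_U ubar, forall i j, (M *m D + 1%:M) i j = 0}.
    apply: (proj1 (feas_blockP M (box_SU ubar_ge0) _) blk) => i j.
    by rewrite notL; apply: DL.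
  have wP u i : in_box ubar u -> i \in lcp_P qbar M ->
      (M *m affine D r u + (qbar + u)) i 0 = 0.
    move=> inu iP; rewrite wE mxE (lcp_sol_P M_psd) // addr0.
    by rewrite (mulmx_box (ubar := ubar)) // big1 // => j jU; rewrite BP // mul0r.
  have zL u i : i \in lcp_L qbar M -> affine D r u i 0 = 0.
    move=> iL; rewrite mxE (lcp_sol_L solr) // addr0 mxE big1 // => j _.
    by rewrite DL // mul0r.
  exists D, r; split=> // u inu; split.
  - move=> i; have [iP|] := boolP (i \in lcp_P qbar M); last first.
      by rewrite notL => /(zL u) ->.
    rewrite mxE; apply: (proj2 (box_row_ge0P ubar_ge0 D i (r i 0))) inu.
    have := A3 i iP; rewrite addrC -[X in _ + X]opprK subr_ge0.
    apply: le_trans; rewrite -sumrN; apply: ler_sum => j jU.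
    (* The two upper bounds on [A i j] together say that it is at most minus [|D i j| * ubar j 0];
       the sign of [D i j] decides which one is used. *)
    rewrite lerNr; have := A1 i j iP jU; have := A2 i j iP jU.
    by case: (ger0P (D i j)) => _; rewrite ?mulNr ?opprK.
  - move=> i; have [iP|] := boolP (i \in lcp_P qbar M); first by rewrite wP.
    rewrite notL => iL; rewrite wE mxE.
    apply: (proj2 (box_row_ge0P ubar_ge0 _ i _)) inu.
    rewrite [leRHS]mxE; have := C3 i iL.
    rewrite -addrA addrC -[X in _ + X]opprK subr_ge0.
    apply: le_trans; rewrite -sumrN; apply: ler_sum => j jU.
    rewrite lerNr BE; have := C1 i j iL jU; have := C2 i j iL jU.
    by case: (ger0P ((M *m D) i j + _)) => _; rewrite ?mulNr ?opprK.
  (* Every term has a zero factor: the slack on [P], the variable on [L]. *)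
  - apply/dot_eq0P; rewrite dotE big1 // => i _.
    have [iP|] := boolP (i \in lcp_P qbar M); first by rewrite wP // mulr0.
    by rewrite notL => /(zL u) ->; rewrite mul0r.
move=> infeas [_ [D [r [-> Dh DS aar]]]]; apply: infeas.
have solr : lcp_sol qbar M r.
  by have := aar 0 (in_box0 ubar_ge0); rewrite /affine mulmx0 add0r addr0.
have zrow i : \sum_(j in box_U ubar) `|D i j| * ubar j 0 <= r i 0.
  by apply/box_row_ge0P => // u /aar [/(_ i) + _ _]; rewrite mxE.
have wrow i : \sum_(j in box_U ubar) `|(M *m D + 1%:M) i j| * ubar j 0
    <= (M *m r + qbar) i 0.
  by apply/box_row_ge0P => // u /aar [_ /(_ i) + _]; rewrite wE mxE.
(* Here [r i 0 = 0], so row [i] of [D *m u] is itself nonnegative on the box; the columns in [S]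
   vanish by convention. *)
have DL i j : i \in lcp_L qbar M -> D i j = 0.
  move=> iL; have [jU|] := boolP (j \in box_U ubar); last by rewrite -box_SU //; apply: DS.
  apply: (box_row_eq0 (ubar := ubar)) => // u inu.
  have := proj2 (box_row_ge0P ubar_ge0 _ _ _) (zrow i) u inu.
  by rewrite (lcp_sol_L solr iL) addr0.
(* The largest [A] and [C] that the pairs of upper bounds allow; the sum constraints then become the
   worst-case bounds [zrow] and [wrow]. *)
exists r, (\matrix_(i, j) (- (`|D i j| * ubar j 0))),
  (\matrix_(i, j) (- (`|(M *m D + 1%:M) i j| * ubar j 0))), D.
have [r0 w0 qr symr] := proj1 (lcp_solP M_psd r zbar_sol) solr.
have le_abs (a b : R) : 0 <= b -> - (`|a| * b) <= a * b /\ - (`|a| * b) <= - a * b.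
  by move=> b0; rewrite -mulNr !ler_wpM2r // ?lerN2 ?ler_norm // lerNl -normrN ler_norm.
split=> //.
- apply/feas_blockP; first exact: box_SU.
    by move=> i j; rewrite notL; apply: DL.
  move=> i j iP jU; apply: (box_row_eq0 (ubar := ubar)) => // u inu.
  have := proj2 (box_row_ge0P ubar_ge0 _ _ _) (wrow i) u inu.
  by rewrite (lcp_sol_P M_psd solr iP) addr0.
- by move=> i j _ _; rewrite mxE; case: (le_abs (D i j) _ (ubar_ge0 j)).
- by move=> i j _ _; rewrite mxE; case: (le_abs (D i j) _ (ubar_ge0 j)).
- move=> i _; under eq_bigr do rewrite mxE.
  by rewrite sumrN addrC subr_ge0.
- by move=> i j _ _; rewrite mxE -BE; case: (le_abs ((M *m D + 1%:M) i j) _ (ubar_ge0 j)).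
- by move=> i j _ _; rewrite mxE -BE; case: (le_abs ((M *m D + 1%:M) i j) _ (ubar_ge0 j)).
- move=> i _; under eq_bigr do rewrite mxE.
  by rewrite sumrN -addrA addrC subr_ge0 (le_trans (wrow i)) // mxE.
Qed.
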